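(* Let $U$ be a parabolic unital of order $q$ in $\mathcal{NP}$ with $(0,1,0)\in U$ such that $\{\phi(1,1,0,t\epsilon):t\in\mathbb{F}_q\}\subseteq\mathrm{Aut}(U)$. If $U$ contains an O'Nan configuration one of whose six points is $(0,1,0)$, then one of the four lines of the configuration is of the form $[0,1,z]$ for some $z\in\mathbb{F}_{q^2}$.
   Context: Let $p$ be an odd prime, $q=p^e$. Fix a primitive element $\xi$ of $\mathbb{F}_{q^2}$ and put $\epsilon=\xi^{(q+1)/2}$ (so $\epsilon^q=-\epsilon$). The regular nearfield $\mathcal N(2,q)$ has underlying set $\mathbb{F}_{q^2}$, field addition, and multiplication $x\star y=xy$ if $y$ is a nonzero square of $\mathbb{F}_{q^2}$, $x\star y=x^qy$ if $y$ is a nonsquare, $x\star0=0$. The plane $\mathcal{NP}$ has points $(x,y,1)$ ($x,y\in\mathbb{F}_{q^2}$), $(1,y,0)$, $(0,1,0)$; lines $[s,1,t]$, $[1,0,t]$ ($s,t\in\mathbb{F}_{q^2}$), $[0,0,1]$ (line at infinity); $(x,y,z)$ lies on $[s,u,t]$ iff $x\star s+y\star u+z\star t=0$; it is a projective plane of order $q^2$. $\phi(c,d,u,v)$ is the collineation acting on affine points by $(x,y,1)\mapsto(x\star c+u,y\star d+v,1)$. A unital of order $q$ is a set of $q^3+1$ points meeting every line in $1$ (tangent) or $q+1$ (secant) points; parabolic means $[0,0,1]$ is tangent; $\mathrm{Aut}(U)$ is the group of collineations preserving $U$. An O'Nan configuration in $U$ is a set of four distinct lines whose six pairwise intersection points are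 distinct points of $U$. *)

(* Defs.v *)
From mathcomp Require Import all_boot all_order all_algebra all_fingroup.
Set Implicit Arguments.
Unset Strict Implicit.
Unset Printing Implicit Defensive.
Import GRing.Theory.
Local Open Scope ring_scope.

(* F plays the role of the field with q^2 elements, q odd. *)
Section Plane.
Variables (F : finFieldType) (q : nat).

(* Multiplication of the regular nearfield N(2,q). *)
Definition nfmul (x y : F) : F :=
  if y == 0 then 0
  else if [exists r : F, y == r ^+ 2] then x * y else x ^+ q * y.

Definition is_point (P : F * F * F) : bool :=
  let: (x, y, z) := P in
  (z == 1) || ((z == 0) && ((x == 1) || ((x == 0) && (y == 1)))).

Definition is_line (l : F * F * F) : bool :=
  let: (s, u, t) := l in
  (u == 1) || ((u == 0) && ((s == 1) || ((s == 0) && (t == 1)))).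

Definition point : Type := {P : F * F * F | is_point P}.
Definition line : Type := {l : F * F * F | is_line l}.

Fact affine_subproof (x y : F) : is_point (x, y, 1).
Proof. by rewrite /= eqxx. Qed.
Fact inftyY_subproof : is_point (0, 1, 0).
Proof. by rewrite /= !eqxx !orbT. Qed.
Fact sline_subproof (s t : F) : is_line (s, 1, t).
Proof. by rewrite /= eqxx. Qed.
Fact line_inf_subproof : is_line (0, 0, 1).
Proof. by rewrite /= !eqxx !orbT. Qed.

(* The points (x,y,1) and (0,1,0), and the lines [s,1,t] and [0,0,1]. *)
Definition affine (x y : F) : point := Sub (x, y, 1) (affine_subproof x y).
Definition inftyY : point := Sub (0, 1, 0) inftyY_subproof.
Definition sline (s t : F) : line := Sub (s, 1, t) (sline_subproof s t).
Definition line_inf : line := Sub (0, 0, 1) line_inf_subproof.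

Definition incident (P : point) (l : line) : bool :=
  let: (x, y, z) := val P in
  let: (s, u, t) := val l in
  nfmul x s + nfmul y u + nfmul z t == 0.

Definition points_on (l : line) : {set point} := [set P | incident P l].

Definition collineation (g : {perm point}) : bool :=
  [forall l : line, exists m : line, g @: points_on l == points_on m].

(* A collineation is determined by its action on the affine points, so for
   given c, d, u, v at most one g satisfies this: it is phi(c,d,u,v). *)
Definition is_phi (c d u v : F) (g : {perm point}) : Prop :=
  collineation g /\
  forall x y : F, g (affine x y) = affine (nfmul x c + u) (nfmul y d + v).

Definition tangent (U : {set point}) (l : line) : bool :=
  #|U :&: points_on l| == 1%N.
Definition secant (U : {set point}) (l : line) : bool :=
  #|U :&: points_on l| == q.+1.

Definition unital (U : {set point}) : Prop :=
  #|U| = (q ^ 3).+1 /\ forall l : line, tangent U l || secant U l.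

Definition parabolic (U : {set point}) : bool := tangent U line_inf.

Definition AutU (U : {set point}) : {set {perm point}} :=
  [set g | collineation g & g @: U == U].

(* Four lines l i, with P i j the point of intersection of l i and l j for i < j
   (the values of P outside i < j are irrelevant). *)
Definition ONan_configuration (U : {set point})
    (l : 'I_4 -> line) (P : 'I_4 -> 'I_4 -> point) : Prop :=
  [/\ injective l,
      forall i j : 'I_4, (i < j)%N ->
        [/\ incident (P i j) (l i), incident (P i j) (l j) & P i j \in U]
    & forall i j i' j' : 'I_4, (i < j)%N -> (i' < j')%N ->
        P i j = P i' j' -> i = i' /\ j = j'].

End Plane.
Arguments inftyY {F}.
Arguments line_inf {F}.

(* Main.v *)
(* Write tr y = y + y^q, so that the kernel of tr is F_q eps. The group makes
   the affine part of U the set of (x, y) with tr y = h x, for a function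
   h : F -> F_q. Since tr (x * s) for the nearfield product equals tr (x s') with
   s -> s' bijective, the graph of h is an ovoid-like set of q^2 points in
   AG(3, q): every non-vertical plane meets it in 1 or q + 1 points. An O'Nan
   configuration through (0,1,0) has two lines x = a, x = b and two lines meeting
   at x = c, and yields three collinear points of this graph above a, b and c. A
   count over the pencil of planes through them shows that this is impossible,
   so that no O'Nan configuration has (0,1,0) as one of its points. *)
Require Import Defs.
From mathcomp Require Import all_boot all_order all_algebra all_fingroup.
From mathcomp Require Import finfield zify.
Set Implicit Arguments.
Unset Strict Implicit.
Unset Printing Implicit Defensive.
Import GRing.Theory.
Local Open Scope ring_scope.

(** Termwise bounds whose totals agree are tight. This turns the upper bounds on fibers and on
    vertical sections into exact sizes. *)
Lemma eq_leq_sum (I : finType) (A : {pred I}) (f g : I -> nat) :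
    {in A, forall i, f i <= g i}%N ->
    (\sum_(i in A) g i <= \sum_(i in A) f i)%N ->
  {in A, f =1 g}.
Proof.
move=> le_fg le_sum i Ai.
have H := leqif_sum (fun i (Ai : i \in A) => leqif_eq (le_fg i Ai)).
by move: le_sum; rewrite (geq_leqif H) => /forall_inP/(_ i Ai)/eqP.
Qed.

Lemma card_root_le (R : finFieldType) (f : {poly R}) (n : nat) :
  f != 0 -> (size f <= n.+1)%N -> (#|[set x | root f x]| <= n)%N.
Proof.
move=> nz_f le_f; rewrite -ltnS; apply: leq_trans le_f; rewrite cardE.
apply: max_poly_roots => //; last exact: enum_uniq.
by apply/allP=> x; rewrite mem_enum inE.
Qed.

(** * The trace to the subfield with q elements, and the counting argument *)

Section Trace.

Variables (F : finFieldType) (q : nat).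
Hypotheses (q_pchar : [pchar F].-nat q) (cardF : #|F| = (q ^ 2)%N).

Definition tr (y : F) : F := y + y ^+ q.
Definition Fq : {set F} := [set t | t ^+ q == t].

Lemma q_gt1 : (1 < q)%N.
Proof. by have := finNzRing_gt1 F; rewrite cardF -[1%N](exp1n 2) ltn_exp2r. Qed.

Lemma q_gt0 : (0 < q)%N. Proof. exact: ltnW q_gt1. Qed.

Lemma frobD (x y : F) : (x + y) ^+ q = x ^+ q + y ^+ q.
Proof. exact: exprDn_pchar. Qed.

Lemma frobN (x : F) : (- x) ^+ q = - x ^+ q.
Proof.
apply/eqP; rewrite -addr_eq0 -frobD addNr expr0n.
by rewrite gtn_eqF ?q_gt0.
Qed.

Lemma frobK (x : F) : (x ^+ q) ^+ q = x.
Proof. by rewrite -exprM mulnn -cardF expf_card. Qed.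

Lemma trD (x y : F) : tr (x + y) = tr x + tr y.
Proof. by rewrite /tr frobD addrACA. Qed.

Lemma trN (x : F) : tr (- x) = - tr x.
Proof. by rewrite /tr frobN opprD. Qed.

Lemma tr_Fq (y : F) : tr y \in Fq.
Proof. by rewrite inE /tr frobD frobK addrC. Qed.

Lemma tr_frob (y : F) : tr (y ^+ q) = tr y.
Proof. by rewrite /tr frobK addrC. Qed.

Lemma trZ (t y : F) : t \in Fq -> tr (t * y) = t * tr y.
Proof. by rewrite inE => /eqP tq; rewrite /tr exprMn tq mulrDr. Qed.

Lemma FqD (x y : F) : x \in Fq -> y \in Fq -> x + y \in Fq.
Proof. by rewrite !inE frobD => /eqP-> /eqP->. Qed.

Lemma FqN (x : F) : x \in Fq -> - x \in Fq.
Proof. by rewrite !inE frobN => /eqP->. Qed.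

Lemma Fq_div (x y : F) : x \in Fq -> y \in Fq -> x / y \in Fq.
Proof. by rewrite !inE exprMn exprVn => /eqP-> /eqP->. Qed.

Lemma size_XnDl (f : {poly F}) : (size f <= 2)%N -> size ('X^q + f) = q.+1.
Proof.
move=> size_f; rewrite size_polyDl size_polyXn // ltnS.
by rewrite (leq_trans size_f) ?q_gt1.
Qed.

Lemma card_Fq_le : (#|Fq| <= q)%N.
Proof.
have sz : size ('X^q - 'X : {poly F}) = q.+1.
  by rewrite size_XnDl // size_polyN size_polyX.
have nz : 'X^q - 'X != 0 :> {poly F} by rewrite -size_poly_eq0 sz.
apply: leq_trans (card_root_le nz (eq_leq sz)).
apply/subset_leq_card/subsetP=> x; rewrite !inE => /eqP xq.
by rewrite /root !hornerE xq subrr.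
Qed.

(** The fiber consists of roots of X^q + X - r, a polynomial of degree q. *)
Lemma card_tr_fiber_le (r : F) : (#|[set y | tr y == r]| <= q)%N.
Proof.
have sz : size ('X^q + ('X - r%:P) : {poly F}) = q.+1.
  by rewrite size_XnDl // size_XsubC.
have nz : 'X^q + ('X - r%:P) != 0 :> {poly F} by rewrite -size_poly_eq0 sz.
apply: leq_trans (card_root_le nz (eq_leq sz)).
apply/subset_leq_card/subsetP=> x; rewrite !inE => /eqP xq.
by rewrite /root hornerD hornerXn hornerXsubC addrCA addrA -/(tr x) xq subrr.
Qed.

Lemma sum_tr_fiber : (\sum_(r in Fq) #|[set y | tr y == r]| = q * q)%N.
Proof.
rewrite mulnn -cardF -sum1_card [RHS](partition_big tr [in Fq]) /= => [|y _].
  by apply: eq_bigr => r _; rewrite sum1dep_card.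
exact: tr_Fq.
Qed.

(** The q^2 elements of [F] fall into at most q trace fibers of size at most q, so both bounds are
    attained. *)
Lemma card_Fq : #|Fq| = q.
Proof.
apply/eqP; rewrite eqn_leq card_Fq_le -(leq_pmul2r q_gt0) -sum_tr_fiber.
by rewrite -sum_nat_const leq_sum // => r _; apply: card_tr_fiber_le.
Qed.

Lemma card_tr_fiber (r : F) : r \in Fq -> #|[set y | tr y == r]| = q.
Proof.
apply: (eq_leq_sum (f := fun r => #|[set y | tr y == r]|) (g := fun=> q)).
  by move=> i _; apply: card_tr_fiber_le.
by rewrite sum_nat_const card_Fq sum_tr_fiber.
Qed.

Lemma card_tr_scale_fiber (m k : F) :
  m != 0 -> k \in Fq -> #|[set x | tr (x * m) == k]| = q.
Proof.
move=> nz_m kFq; rewrite -(card_tr_fiber kFq).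
rewrite -(card_preimset [set y | tr y == k] (mulIf nz_m)).
by congr #|pred_of_set _|; apply/setP=> x; rewrite !inE.
Qed.

(* The points (x, h x) of the graph that lie on the F_q-line through the three
   given ones are N >= 3 in number. The q non-vertical planes through that line
   each contain q + 1 points of the graph, and each of the q^2 - q points of the
   graph outside the vertical plane through it is on exactly one of them, hence
   q (q + 1) = N q + (q^2 - q), that is, N = 2. *)
Lemma no_three_collinear (h : F -> F) (s m a b c r : F) :
    (forall x, h x \in Fq) ->
    (forall s t : F, #|[set x | h x + tr (x * s) + tr t == 0]| \in [:: 1; q.+1]%N) ->
    m != 0 -> uniq [:: a; b; c] ->
    {in [:: a; b; c], forall x, tr (x * m) = tr (a * m)} ->
    {in [:: a; b; c], forall x, h x + tr (x * s) = r} -> False.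
Proof.
move=> hFq type_h nz_m uniq_abc coll_abc level_abc.
pose k := tr (a * m); pose g x := h x + tr (x * s).
have gFq x : g x \in Fq by rewrite FqD ?hFq ?tr_Fq.
have rFq : r \in Fq by rewrite -(level_abc a) ?gFq ?mem_head.
pose N := #|[set x | (tr (x * m) == k) && (g x == r)]|.
have N_gt2 : (2 < N)%N.
  rewrite -[3%N]/(size [:: a; b; c]) -(card_uniqP uniq_abc).
  apply/subset_leq_card/subsetP=> x abc_x.
  by rewrite inE coll_abc // /g level_abc ?eqxx.
(* For l in F_q these are the non-vertical planes of the pencil; the vertical one is tr (x m) =
   k. *)
pose inc l x := g x + l * tr (x * m) == r + l * k.
have card_inc l : l \in Fq -> #|[set x | inc l x]| = q.+1.
  move=> lFq.
  have [t trt] : exists t, tr t = - (r + l * k).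
    have : - (r + l * k) \in Fq by rewrite FqN // FqD // -trZ ?tr_Fq.
    move/card_tr_fiber => card_t.
    have /card_gt0P[t] : (0 < #|[set y | tr y == - (r + l * k)]|)%N.
      by rewrite card_t q_gt0.
    by rewrite inE => /eqP; exists t.
  (* By F_q-linearity of the trace, the parameter l is absorbed in the slope s + l m, so [type_h]
     applies. *)
  have eq_inc :
      [set x | inc l x] = [set x | h x + tr (x * (s + l * m)) + tr t == 0].
    apply/setP=> x; rewrite !inE trt subr_eq0 mulrDr trD addrA mulrCA.
    by rewrite (trZ _ lFq).
  have := type_h (s + l * m) t; rewrite -eq_inc !inE => /orP[|/eqP//].
  (* Size 1 is excluded, since every plane of the pencil contains the [N] > 2 collinear points. *)
  rewrite eqn_leq leqNgt => /andP[/negP le1 _]; case: le1.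
  apply: leq_trans (ltnW N_gt2) _; apply/subset_leq_card/subsetP=> x.
  by rewrite !inE /inc => /andP[/eqP-> /eqP->].
have sum_inc : (\sum_(l in Fq) \sum_x inc l x = q * q.+1)%N.
  rewrite -[X in (X * _)%N]card_Fq -sum_nat_const; apply: eq_bigr => l lFq.
  by rewrite -(card_inc l lFq) -sum1dep_card [RHS]big_mkcond.
(* Over the vertical plane the terms in l cancel: the point is on all planes of the pencil or on
   none. *)
have sum_on x : tr (x * m) = k -> (\sum_(l in Fq) inc l x = (g x == r) * q)%N.
  move=> xk; rewrite -[q in RHS]card_Fq mulnC -sum_nat_const.
  by apply: eq_bigr => l _; rewrite /inc xk (inj_eq (addIr _)).
have sum_off x : tr (x * m) != k -> (\sum_(l in Fq) inc l x = 1)%N.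
  (* [l0] is the unique solution l of g x + l tr (x m) = r + l k. *)
  rewrite -subr_eq0 => nz_xk; pose l0 := (r - g x) / (tr (x * m) - k).
  have l0Fq : l0 \in Fq.
    exact: Fq_div (FqD rFq (FqN (gFq x))) (FqD (tr_Fq _) (FqN (tr_Fq _))).
  rewrite (bigD1 l0) //= big1 ?addn0 => [|l /andP[_ ne_l]].
    rewrite /inc -subr_eq0 opprD addrACA -mulrBr /l0 divfK // addrC.
    by rewrite subrKA subrr eqxx.
  apply/eqP; rewrite eqb0; apply: contra ne_l => /eqP inc_l.
  rewrite -(inj_eq (mulIf nz_xk)) divfK // mulrBr subr_eq addrAC.
  by rewrite -inc_l addrAC subrr add0r.
have : (q * q.+1 = N * q + (q ^ 2 - q))%N.
  rewrite -sum_inc exchange_big /= (bigID (fun x => tr (x * m) == k)) /=.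
  congr (_ + _)%N.
    rewrite (eq_bigr (fun x => (g x == r) * q)%N) => [|x /eqP/sum_on //].
    rewrite -big_distrl /=; congr (_ * _)%N.
    rewrite /N -sum1dep_card [RHS]big_mkcondr.
    by apply: eq_bigr => x _; case: (g x == r).
  rewrite (eq_bigr (fun=> 1%N)) => [|x /sum_off //].
  rewrite sum1dep_card -cardF -(cardsC [set x | tr (x * m) == k]).
  rewrite card_tr_scale_fiber ?tr_Fq // addKn.
  by congr #|pred_of_set _|; apply/setP=> x; rewrite !inE.
have : (3 * q <= N * q)%N by rewrite leq_mul2r N_gt2 orbT.
have : (q <= q * q)%N by rewrite leq_pmull ?q_gt0.
have := q_gt0; rewrite mulnS -mulnn; lia.
Qed.

End Trace.

(** * Nearfield products under the trace, and coordinates in the plane *)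

Section Unital.

Variables (F : finFieldType) (q : nat).
Hypotheses (q_pchar : [pchar F].-nat q) (cardF : #|F| = (q ^ 2)%N).

Let q_gt0 : (0 < q)%N := q_gt0 cardF.

Definition is_square (s : F) : bool := [exists r : F, s == r ^+ 2].

Lemma is_squareX (s : F) (n : nat) : is_square s -> is_square (s ^+ n).
Proof.
by case/existsP=> r /eqP->; apply/existsP; exists (r ^+ n); rewrite exprAC.
Qed.

Lemma is_square0 : is_square 0.
Proof. by apply/existsP; exists 0; rewrite expr0n. Qed.

Lemma is_square1 : is_square 1.
Proof. by apply/existsP; exists 1; rewrite expr1n. Qed.

(* The slope whose field multiplication has the same traces as the nearfield
   multiplication by s. *)
Definition slope (s : F) : F := if is_square s then s else s ^+ q.

(** The map s -> s^q is an involution preserving squares, hence also nonsquares, so the two branches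
    have disjoint images. *)
Lemma slope_inj : injective slope.
Proof.
rewrite /slope => s t; case: ifPn => Ss; case: ifPn => St // E.
- by case/negP: St; rewrite -(frobK cardF t) -E is_squareX.
- by case/negP: Ss; rewrite -(frobK cardF s) E is_squareX.
- by rewrite -(frobK cardF s) E (frobK cardF).
Qed.

Lemma slope_surj (s : F) : exists s', slope s' = s.
Proof. by have [g _ gK] := injF_bij slope_inj; exists (g s). Qed.

(** For a nonsquare s, x^q s and x s^q are conjugate, hence have the same trace. *)
Lemma tr_nfmul (x s : F) : tr q (nfmul q x s) = tr q (x * slope s).
Proof.
rewrite /nfmul /slope -/(is_square s); have [->|_] := eqVneq s 0.
  by rewrite is_square0 mulr0.
case: ifP => // _.
by rewrite -(tr_frob cardF) exprMn (frobK cardF).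
Qed.

Lemma nfmulr0 (x : F) : nfmul q x 0 = 0.
Proof. by rewrite /nfmul eqxx. Qed.

Lemma nfmulr1 (x : F) : nfmul q x 1 = x.
Proof. by rewrite /nfmul oner_eq0 -/(is_square 1) is_square1 mulr1. Qed.

Lemma nfmul0r (s : F) : nfmul q 0 s = 0.
Proof. by rewrite /nfmul expr0n gtn_eqF // mul0r !if_same. Qed.

Lemma nfmul1r (s : F) : nfmul q 1 s = s.
Proof.
by rewrite /nfmul expr1n mul1r if_same; case: eqVneq.
Qed.

Fact vline_subproof (t : F) : is_line (1, 0, t).
Proof. by rewrite /= !eqxx orbT. Qed.

Definition vline (t : F) : line F := Sub (1, 0, t) (vline_subproof t).

Lemma lineP (m : line F) :
  [\/ exists s t, m = sline s t, exists t, m = vline t | m = line_inf].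
Proof.
case: m => [[[s u] t] m_line].
have /= /orP[/eqP u1|/andP[/eqP u0 /orP[/eqP s1|]]] := m_line.
- by constructor 1; exists s, t; apply: val_inj; rewrite /= u1.
- by constructor 2; exists t; apply: val_inj; rewrite /= u0 s1.
- move=> /andP[/eqP s0 /eqP t1]; constructor 3; apply: val_inj.
  by rewrite /= u0 s0 t1.
Qed.

Lemma affineVinf (A : point F) :
  (exists x y, A = affine x y) \/ incident q A line_inf.
Proof.
case: A => [[[x y] z] A_point]; rewrite /incident /= !nfmulr0 nfmulr1 !add0r.
have /= /orP[/eqP z1|/andP[-> _]] := A_point; last by right.
by left; exists x, y; apply: val_inj; rewrite /= z1.
Qed.

Lemma affine_inj (x y x' y' : F) :
  affine x y = affine x' y' -> x = x' /\ y = y'.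
Proof. by move/(congr1 val) => [-> ->]. Qed.

Lemma affine_neq_inftyY (x y : F) : affine x y != inftyY.
Proof. by rewrite -val_eqE /= !xpair_eqE oner_eq0 andbF. Qed.

Lemma incident_affine_sline (x y s t : F) :
  incident q (affine x y) (sline s t) = (nfmul q x s + y + t == 0).
Proof. by rewrite /incident /= nfmulr1 nfmul1r. Qed.

Lemma incident_affine_vline (x y t : F) :
  incident q (affine x y) (vline t) = (x == - t).
Proof. by rewrite /incident /= nfmulr1 nfmulr0 nfmul1r addr0 addr_eq0. Qed.

Lemma incident_inftyY_sline (s t : F) :
  incident q inftyY (sline s t) = false.
Proof. by rewrite /incident /= !nfmul0r nfmul1r add0r addr0 oner_eq0. Qed.

Lemma incident_inftyY_vline (t : F) : incident q inftyY (vline t).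
Proof. by rewrite /incident /= !nfmul0r nfmul1r !addr0. Qed.

Lemma incident_inftyY_line_inf : incident q inftyY (@line_inf F).
Proof. by rewrite /incident /= !nfmul0r nfmul1r !addr0. Qed.

(** * The unital as a union of trace fibers *)

Variables (U : {set point F}).
Hypotheses (U_unital : unital q U) (U_parabolic : parabolic q U).
Hypothesis (U_inftyY : inftyY \in U).

Lemma unital_line_inf (A : point F) :
  A \in U -> incident q A line_inf -> A = inftyY.
Proof.
move=> UA infA; have /cards1P[B defB] := U_parabolic.
have UB C : C \in U -> incident q C line_inf -> C = B.
  by move=> UC infC; apply/set1P; rewrite -defB !inE UC.
by rewrite (UB A) // (UB inftyY) // incident_inftyY_line_inf.
Qed.

Lemma unital_affine (A : point F) :
  A \in U -> A != inftyY -> exists x y, A = affine x y.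
Proof.
move=> UA /eqP neA; have [//|infA] := affineVinf A.
by case: neA; apply: unital_line_inf.
Qed.

Lemma card_line_section_le (m : line F) : (#|U :&: points_on q m| <= q.+1)%N.
Proof. by have [_ /(_ m)/orP[] /eqP->] := U_unital. Qed.

(** A vertical line has at most q + 1 points of [U], one of them [inftyY]. The q^2 vertical lines
    must cover the q^3 affine points of [U], so each carries exactly q of them. *)
Lemma card_vertical_section (x : F) : #|[set y | affine x y \in U]| = q.
Proof.
pose V x := [set y | affine x y \in U].
have le_V z : (#|V z| <= q)%N.
  rewrite -ltnS; apply: leq_trans (card_line_section_le (vline (- z))).
  rewrite -(card_imset (V z) (f := affine z)) => [|y y' /affine_inj[]//].
  have infV : inftyY \notin affine z @: V z.
    apply/imsetP=> -[y _ /eqP].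
    by rewrite eq_sym (negPf (affine_neq_inftyY z y)).
  have := cardsU1 inftyY (affine z @: V z); rewrite infV add1n => <-.
  apply/subset_leq_card/subsetP=> A.
  rewrite !inE => /predU1P[->|/imsetP[y + ->]].
    by rewrite U_inftyY incident_inftyY_vline.
  by rewrite !inE incident_affine_vline opprK eqxx => ->.
apply: (eq_leq_sum (A := predT) (f := fun z => #|V z|) (g := fun=> q)) => //.
rewrite sum_nat_const cardF -expnSr.
pose W := [set p : F * F | affine p.1 p.2 \in U].
have -> : (\sum_z #|V z| = #|W|)%N.
  rewrite -sum1dep_card -(pair_big_dep predT (fun z y => affine z y \in U)
    (fun _ _ => 1%N)) /=.
  by apply: eq_bigr => z _; rewrite sum1dep_card.
rewrite -ltnS -U_unital.1 (cardsD1 inftyY) U_inftyY add1n ltnS.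
apply: leq_trans (leq_imset_card (fun p => affine p.1 p.2) W).
apply/subset_leq_card/subsetP=> A; rewrite !inE => /andP[neA UA].
have [z [y defA]] := unital_affine UA neA.
by apply/imsetP; exists (z, y); rewrite ?inE -?defA.
Qed.

Variable eps : F.
Hypotheses (nz_eps : eps != 0) (eps_frob : eps ^+ q = - eps).
Hypothesis U_phi : forall t : F, t ^+ q = t ->
  exists2 g : {perm point F}, is_phi q 1 1 0 (t * eps) g & g \in AutU q U.

(** The difference y' - y has trace 0, so Frobenius negates it, as it does [eps]. Their quotient t
    therefore lies in F_q, and the translation by t eps maps one point to the other. *)
Lemma unital_tr_invariant (x y y' : F) :
  tr q y = tr q y' -> affine x y \in U -> affine x y' \in U.
Proof.
move=> eq_tr Uxy; have [|g [_ def_g]] := U_phi (t := (y' - y) / eps).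
  have frob_y : (y' - y) ^+ q = - (y' - y).
    apply/eqP; rewrite -addr_eq0 addrC -/(tr q _).
    by rewrite (trD q_pchar) (trN q_pchar cardF) eq_tr subrr.
  by rewrite exprMn exprVn eps_frob frob_y invrN mulrNN.
rewrite inE => /andP[_ /eqP gU]; have := imset_f g Uxy.
by rewrite gU def_g !nfmulr1 addr0 divfK // addrC subrK.
Qed.

(** A vertical section contains a full trace fiber by invariance, and both have q elements. *)
Lemma unital_trace_graph :
  exists2 h : F -> F, forall x, h x \in Fq F q
    & forall x y, (affine x y \in U) = (tr q y == h x).
Proof.
have /fin_all_exists2[h hFq hU] :
    forall x, exists2 r, r \in Fq F q & forall y, (affine x y \in U) = (tr q y == r).
  move=> x; pose V := [set y | affine x y \in U].
  have /card_gt0P[y0] : (0 < #|V|)%N by rewrite card_vertical_section.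
  rewrite inE => Uy0; exists (tr q y0) => [|y]; first exact: (tr_Fq q_pchar cardF).
  suff /setP/(_ y) : [set y | tr q y == tr q y0] = V by rewrite !inE.
  apply/eqP; rewrite eqEcard card_vertical_section.
  rewrite (card_tr_fiber q_pchar cardF) ?(tr_Fq q_pchar cardF) // leqnn andbT.
  apply/subsetP=> z; rewrite !inE => /eqP eq_tr.
  exact: unital_tr_invariant (esym eq_tr) Uy0.
by exists h.
Qed.

(** The plane section is the projection to the x-coordinate of [U] cut by a line [s', 1, t] with
    [slope s'] = s. This projection is injective because x determines y on such a line. *)
Lemma card_level_trace_graph (h : F -> F) :
    (forall x y, (affine x y \in U) = (tr q y == h x)) ->
  forall s t : F, #|[set x | h x + tr q (x * s) + tr q t == 0]| \in [:: 1; q.+1]%N.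
Proof.
move=> hU s t; have [s' <-] := slope_surj s.
set X := [set x | _]; pose f x := affine x (- (nfmul q x s' + t)).
have f_inj : injective f by move=> x x' /affine_inj[].
suff <- : #|U :&: points_on q (sline s' t)| = #|X|.
  by have [_ /(_ (sline s' t))] := U_unital; rewrite !inE.
have trf x : (tr q (- (nfmul q x s' + t)) == h x) = (x \in X).
  rewrite inE (trN q_pchar cardF) (trD q_pchar) tr_nfmul -[h x + _ + _]addrA addr_eq0.
  by rewrite eq_sym.
rewrite -(card_imset X f_inj); congr #|pred_of_set _|; apply/setP=> A.
rewrite !inE; apply/andP/imsetP=> [[UA lA]|[x Xx ->]]; last first.
  by rewrite hU trf Xx incident_affine_sline addrAC subrr.
have neA : A != inftyY.
  by apply: contraTneq lA => ->; rewrite incident_inftyY_sline.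
have [x [y defA]] := unital_affine UA neA; subst A; exists x.
  rewrite incident_affine_sline addrAC addrC addr_eq0 in lA.
  by rewrite -trf -hU -(eqP lA).
rewrite incident_affine_sline addrAC addrC addr_eq0 in lA.
by rewrite /f -(eqP lA).
Qed.

Lemma trace_graph_line (h : F -> F) (x y s t : F) :
    (forall x y, (affine x y \in U) = (tr q y == h x)) ->
    affine x y \in U -> incident q (affine x y) (sline s t) ->
  h x + tr q (x * slope s) = - tr q t.
Proof.
move=> hU; rewrite hU incident_affine_sline => /eqP <- /eqP line_xy.
rewrite -tr_nfmul [LHS]addrC -(trD q_pchar) -(trN q_pchar cardF).
by congr tr; apply/eqP; rewrite -addr_eq0 line_xy.
Qed.

(** Lines [i] and [j] are vertical, the other two, [k] and [m], are not. At the abscissas of [i], of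
    [j] and of the point common to [k] and [m], the graph of [h] satisfies the equations of both [k]
    and [m]; their difference is a vertical plane, so three points of the graph are collinear. *)
Lemma no_ONan_inftyY (l : 'I_4 -> line F) (P : 'I_4 -> 'I_4 -> point F)
    (i j : 'I_4) :
  ONan_configuration q U l P -> (i < j)%N -> P i j <> inftyY.
Proof.
case=> l_inj P_inc P_inj lt_ij Pij.
have ne_ij : i != j by rewrite neq_ltn lt_ij.
(* A symmetric version of [P], whose values matter only for increasing indices. *)
pose Q (n n' : 'I_4) := if (n < n')%N then P n n' else P n' n.
have QP n n' : n != n' -> exists a b : 'I_4,
    [/\ (a < b)%N, Q n n' = P a b & (a, b) = (n, n') \/ (a, b) = (n', n)].
  rewrite /Q -val_eqE; case: (ltngtP n n') => // lt_n _.
    by exists n, n'; split=> //; left.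
  by exists n', n; split=> //; right.
have Q_U n n' : n != n' -> Q n n' \in U.
  by case/QP=> a [b [lt_ab -> _]]; case: (P_inc _ _ lt_ab).
have Q_l n n' : n != n' -> incident q (Q n n') (l n).
  by case/QP=> a [b [/P_inc[la lb _] -> [[<- _]|[_ <-]]]].
have QC n n' : Q n n' = Q n' n.
  by rewrite /Q; case: ltngtP => // /val_inj->.
have Q_r n n' : n != n' -> incident q (Q n n') (l n').
  by rewrite eq_sym QC; apply: Q_l.
have Q_inj n n' k k' : n != n' -> k != k' -> Q n n' = Q k k' ->
    (n \in [:: k; k']) && (n' \in [:: k; k']).
  move=> /QP[a [b [lt_ab -> ab]]] /QP[c [d [lt_cd -> cd]]].
  move=> /(P_inj _ _ _ _ lt_ab lt_cd)[Ea Eb]; subst a b; rewrite !inE.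
  by case: ab cd => [] [-> ->] [] [-> ->]; rewrite !eqxx ?orbT.
have Qij : Q i j = inftyY by rewrite /Q lt_ij.
have Q_neq n n' : n != n' -> n' \notin [:: i; j] -> Q n n' != inftyY.
  move=> ne_n; apply: contra => /eqP; rewrite -Qij.
  by case/Q_inj/andP.
have vertical n n' : n != n' -> Q n n' != inftyY -> incident q inftyY (l n) ->
    exists2 t, l n = vline t & exists y, Q n n' = affine (- t) y.
  move=> ne_n neQ inf_n; have [x [y defQ]] := unital_affine (Q_U _ _ ne_n) neQ.
  have := Q_l _ _ ne_n; have [[s [t def_n]]|[t def_n]|def_n] := lineP (l n).
  - by rewrite def_n incident_inftyY_sline in inf_n.
  - rewrite defQ def_n incident_affine_vline => /eqP->.
    by exists t => //; exists y.
  (* The line at infinity meets [U] only in [inftyY], so it cannot contain a second point of the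
     configuration. *)
  - rewrite def_n => /(unital_line_inf (Q_U _ _ ne_n))/eqP.
    by rewrite (negPf neQ).
have inf_ij n : n \in [:: i; j] -> incident q inftyY (l n).
  by rewrite !inE -Qij => /pred2P[]->; rewrite ?Q_l ?Q_r.
have vertical_ij n n' : n \in [:: i; j] -> n' \notin [:: i; j] ->
    exists2 t, l n = vline t & exists y, Q n n' = affine (- t) y.
  move=> ij_n ij_n'; have ne_n : n != n' by apply: contraNneq ij_n' => <-.
  by apply: vertical => //; [apply: Q_neq | apply: inf_ij].
have slanted n : n \notin [:: i; j] -> exists s t, l n = sline s t.
  move=> ij_n; have ne_in : i != n by apply: contraNneq ij_n => <-; rewrite mem_head.
  have [t def_i [y defQ]] := vertical_ij i n (mem_head i _) ij_n.
  have [//|[t' def_n]|def_n] := lineP (l n).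
    have := Q_r _ _ ne_in; rewrite defQ def_n incident_affine_vline.
    rewrite (inj_eq oppr_inj) => /eqP eq_t; case/eqP: ne_in.
    by apply: l_inj; rewrite def_i eq_t def_n.
  have := Q_r _ _ ne_in; rewrite def_n => /(unital_line_inf (Q_U _ _ ne_in))/eqP.
  by rewrite (negPf (Q_neq _ _ ne_in ij_n)).
have /cards2P[k [m [ne_km def_km]]] : #|~: [set i; j]| == 2.
  by rewrite cardsCs setCK cards2 card_ord ne_ij.
have ij_k : k \notin [:: i; j].
  by have := set21 k m; rewrite -def_km !inE.
have ij_m : m \notin [:: i; j].
  by have := set22 k m; rewrite -def_km !inE.
have ij_i := mem_head i [:: j].
have ij_j : j \in [:: i; j] by rewrite mem_seq2 eqxx orbT.
have ne_ij_km n n' : n \in [:: i; j] -> n' \notin [:: i; j] -> n != n'.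
  by move=> ij_n; apply: contraNneq => <-.
have [s1 [t1 def_k]] := slanted k ij_k.
have [s2 [t2 def_m]] := slanted m ij_m.
have [c [y_c Qkm]] := unital_affine (Q_U _ _ ne_km) (Q_neq _ _ ne_km ij_m).
have [h hFq hU] := unital_trace_graph.
have level n n' x y s t : n != n' -> Q n n' = affine x y -> l n' = sline s t ->
    h x + tr q (x * slope s) = - tr q t.
  move=> ne_n defQ def_n'; apply: (trace_graph_line (y := y) hU).
    by rewrite -defQ Q_U.
  by rewrite -defQ -def_n' Q_r.
have [a def_i [y_ik Qik]] := vertical_ij i k ij_i ij_k.
have [a' def_i' [y_im Qim]] := vertical_ij i m ij_i ij_m.
have [b def_j [y_jk Qjk]] := vertical_ij j k ij_j ij_k.
have [b' def_j' [y_jm Qjm]] := vertical_ij j m ij_j ij_m.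
have vline_inj t t' : vline t = vline t' -> t = t' by case.
have eq_a : a' = a by apply: vline_inj; rewrite -def_i.
have eq_b : b' = b by apply: vline_inj; rewrite -def_j.
subst a' b'.
(* If a vertical line had abscissa c, it would meet line [k] in the point [Q k m], and two of the
   six points would coincide. *)
have off n t y : n \in [:: i; j] -> Q n k = affine (- t) y -> - t != c.
  move=> ij_n Qnk; apply/eqP=> eq_c; have ne_nk := ne_ij_km _ _ ij_n ij_k.
  have := Q_r _ _ ne_nk; have := Q_l _ _ ne_km.
  rewrite Qkm Qnk def_k !incident_affine_sline eq_c => /eqP <-.
  rewrite (inj_eq (addIr _)) (inj_eq (addrI _)) => /eqP eq_y.
  have /Q_inj : Q k m = Q n k by rewrite Qkm Qnk eq_c eq_y.
  rewrite ne_km ne_nk !inE => /(_ isT isT)/andP[_].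
  rewrite [m == k]eq_sym (negPf ne_km) orbF => /eqP eq_mn.
  by rewrite eq_mn ij_n in ij_m.
have ne_ik := ne_ij_km _ _ ij_i ij_k; have ne_im := ne_ij_km _ _ ij_i ij_m.
have ne_jk := ne_ij_km _ _ ij_j ij_k; have ne_jm := ne_ij_km _ _ ij_j ij_m.
have level1 :
    {in [:: - a; - b; c], forall x, h x + tr q (x * slope s1) = - tr q t1}.
  move=> x; rewrite !inE => /or3P[]/eqP->.
  - exact: level ne_ik Qik def_k.
  - exact: level ne_jk Qjk def_k.
  - by apply: (level m k _ y_c) => //; rewrite 1?eq_sym // QC.
have level2 :
    {in [:: - a; - b; c], forall x, h x + tr q (x * slope s2) = - tr q t2}.
  move=> x; rewrite !inE => /or3P[]/eqP->.
  - exact: level ne_im Qim def_m.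
  - exact: level ne_jm Qjm def_m.
  - exact: level ne_km Qkm def_m.
have coll x : x \in [:: - a; - b; c] ->
    tr q (x * (slope s2 - slope s1)) = tr q t1 - tr q t2.
  move=> abc_x; rewrite mulrBr (trD q_pchar) (trN q_pchar cardF).
  have /(canRL (addKr _))-> := level1 x abc_x.
  have /(canRL (addKr _))-> := level2 x abc_x.
  move: (h x) (tr q t1) (tr q t2) => hx r1 r2.
  by rewrite opprD !opprK addrACA addNr add0r addrC.
apply: (@no_three_collinear _ _ q_pchar cardF h (slope s1)
  (slope s2 - slope s1) (- a) (- b) c (- tr q t1)) => //.
- exact: card_level_trace_graph.
(* Lines [k] and [m] share a point, so equal slopes would make them equal. *)
- rewrite subr_eq0 (inj_eq slope_inj); apply: contra_neq (ne_km) => eq_s.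
  apply: l_inj; rewrite def_k def_m eq_s; congr sline; apply/eqP.
  have := Q_r _ _ ne_km; have := Q_l _ _ ne_km.
  rewrite Qkm def_k def_m !incident_affine_sline eq_s => /eqP <-.
  by rewrite (inj_eq (addrI _)) eq_sym.
- rewrite /= !inE negb_or (off _ _ _ ij_i Qik) (off _ _ _ ij_j Qjk) !andbT.
  rewrite (inj_eq oppr_inj); apply: contraNneq ne_ij => eq_ab.
  by apply/eqP/l_inj; rewrite def_i eq_ab.
- by move=> x abc_x; rewrite !coll ?mem_head.
Qed.

End Unital.

(** Put n = (q + 1)/2 (q - 1), so that xi has order 2n. Then eps^(q-1) = xi^n squares to 1 and
    differs from 1, hence equals -1. *)
Lemma primitive_root_half (q : nat) (F : finFieldType) (xi : F) :
    odd q -> (1 < q)%N -> ((q ^ 2).-1)%N.-primitive_root xi ->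
  let eps := xi ^+ (q.+1)./2 in eps != 0 /\ eps ^+ q = - eps.
Proof.
move=> q_odd q_gt1 xi_prim eps.
have halfE : ((q.+1)./2 * q.-1 * 2 = (q ^ 2).-1)%N.
  by rewrite mulnAC muln2 halfK /= q_odd subn0 -mulnn; lia.
have n_gt0 : (0 < (q.+1)./2 * q.-1)%N.
  by rewrite -(ltn_pmul2r (isT : 0 < 2)%N) halfE (prim_order_gt0 xi_prim).
have eps_half : eps ^+ q.-1 = -1.
  have : (eps ^+ q.-1) ^+ 2 == 1.
    by rewrite /eps -!exprM mulnA halfE (prim_expr_order xi_prim).
  rewrite sqrf_eq1 => /orP[|/eqP//].
  rewrite /eps -exprM -(prim_order_dvd xi_prim) -halfE => /dvdn_leq.
  by rewrite n_gt0 => /(_ isT); rewrite leqNgt ltn_Pmulr.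
split.
  apply: contra_eq_neq eps_half => ->.
  by rewrite expr0n -subn1 subn_eq0 leqNgt q_gt1 eq_sym oppr_eq0 oner_neq0.
by rewrite -[q in LHS]prednK 1?ltnW // exprS eps_half mulrN1.
Qed.

Theorem theorem6p4 (p e q : nat) (F : finFieldType) (xi eps : F)
    (U : {set point F}) (l : 'I_4 -> line F) (P : 'I_4 -> 'I_4 -> point F)
    (p_prime : prime p) (p_odd : odd p) (e_gt0 : (0 < e)%N)
    (q_def : q = (p ^ e)%N) (cardF : #|F| = (q ^ 2)%N)
    (xi_prim : ((q ^ 2).-1)%N.-primitive_root xi)
    (eps_def : eps = xi ^+ ((q.+1)./2))
    (U_unital : unital q U) (U_parabolic : parabolic q U)
    (U_inftyY : inftyY \in U)
    (* F_q is the set of t in F with t^q = t *)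
    (U_phi : forall t : F, t ^+ q = t ->
       exists2 g : {perm point F}, is_phi q 1 1 0 (t * eps) g & g \in AutU q U)
    (lP_ONan : ONan_configuration q U l P)
    (P_inftyY : exists i j : 'I_4, (i < j)%N /\ P i j = inftyY) :
  exists (i : 'I_4) (z : F), l i = sline 0 z.
Proof.
have p_char : p \in [pchar F].
  by apply: (card_finPcharP (n := (e * 2)%N)); rewrite // cardF q_def expnM.
have q_pchar : [pchar F].-nat q.
  by rewrite q_def (eq_pnat _ (pcharf_eq p_char)) pnatX pnat_id.
have q_odd : odd q by rewrite q_def oddX p_odd orbT.
have [nz_eps eps_frob] := primitive_root_half q_odd (q_gt1 cardF) xi_prim.
rewrite -eps_def in nz_eps eps_frob.
have [i [j [lt_ij Pij]]] := P_inftyY.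
(* The given configuration is contradictory. *)
by case: (no_ONan_inftyY q_pchar cardF U_unital U_parabolic U_inftyY nz_eps
  eps_frob U_phi lP_ONan lt_ij).
Qed.
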